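(* Let $G$ be a duality admissible graph. Then for every prime power $q$ the $c_2$ invariants of $G$ for the parametric and the dual parametric representations coincide: $$c_2^{\mathrm{dual}}(G)_q = c_2(G)_q\quad\text{in }\mathbb{Z}/q\mathbb{Z}.$$
   Context: Graphs are finite and may have multiple edges and self-loops. For a graph $G$ let $N_G$ be its number of edges $e_1,\dots,e_{N_G}$, $n_G=|V(G)|-1$, and $h_G=N_G-n_G$. $G$ is log-divergent if $N_G=2h_G$ (equivalently $N_G=2n_G$). Graph polynomial and dual graph polynomial: $\Psi_G=\sum_T\prod_{e\notin T}\alpha_e$ and $\varphi_G=\sum_T\prod_{e\in T}\alpha_e$ in $\mathbb{Z}[\alpha_1,\dots,\alpha_{N_G}]$, the sums running over spanning trees $T$ of $G$ (both are $0$ if $G$ is disconnected). For a polynomial $f\in\mathbb{Z}[a_1,\dots,a_N]$ and a prime power $q$, $[f]_q$ denotes the number of zeros of $f$ (reduced to $\mathbb{F}_q$) in $\mathbb{F}_q^N$. If $n_G\ge2$ then $q^2\mid[\Psi_G]_q$ and $c_2(G)_q:=[\Psi_G]_q/q^2\bmod q$. If $h_G\ge2$ then $q^2\mid[\varphi_G]_q$ and $c_2^{\mathrm{dual}}(G)_q:=[\varphi_G]_q/q^2\bmod q$. Here $\Psi_G,\varphi_G$ are regarded as polynomials in all $N_G$ variables. For disjoint $I,J\subset\{1,\dots,N_G\}$ let $\varphi^J_{I}$ be the polynomial in the $N_G-|I|-|J|$ variables $\alpha_k$, $k\notin I\cup J$, obtained from $\varphi_G$ by taking the coefficient of $\prod_{j\in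 J}\alpha_j$ and setting $\alpha_i=0$ for $i\in I$; i.e. $\varphi^J_I=\sum_{T\supset J,\,T\cap I=\emptyset}\prod_{e\in T\setminus J}\alpha_e$. A log-divergent graph $G$ with $h_G,n_G\ge3$ is called duality admissible if for every prime power $q$ one has $[\varphi^J_I]_q\equiv0\bmod q^3$ (zeros counted in $\mathbb{F}_q^{N_G-|I|-|J|}$) for all disjoint $I,J\subset\{1,\dots,N_G\}$ with $|I|<|J|\le n_G$ and $0\le|I|\le n_G-3$. *)

(* Defs.v *)
From HB Require Import structures.
From mathcomp Require Import all_boot all_order all_algebra.
From mathcomp Require Import mpoly.

Set Implicit Arguments.
Unset Strict Implicit.
Unset Printing Implicit Defensive.

Import GRing.Theory.
Local Open Scope ring_scope.

(* The order of the two components of [ends e] is irrelevant. *)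
Record multigraph := Multigraph {
  vertex : finType;
  nb_edges : nat;
  ends : 'I_nb_edges -> vertex * vertex
}.

Section MultigraphDefs.

Variable G : multigraph.

Local Notation V := (vertex G).
Local Notation N := (nb_edges G).

(* Integer-valued, so that neither subtraction is truncated. *)
Definition nG : int := #|V|%:Z - 1.
Definition hG : int := N%:Z - nG.

Definition log_divergent : Prop := N%:Z = 2 * hG.

Definition joins (e : 'I_N) (x y : V) : bool :=
  (ends e == (x, y)) || (ends e == (y, x)).

Definition adj (T : {set 'I_N}) : rel V :=
  [rel x y | [exists e in T, joins e x y]].

Definition connected_sub (T : {set 'I_N}) : bool :=
  [forall x, forall y, connect (adj T) x y].

(* A walk from [x] is the list of its steps: (edge traversed, vertex reached). *)
Fixpoint walk (x : V) (p : seq ('I_N * V)) : bool :=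
  if p is (e, y) :: p' then joins e x y && walk y p' else true.

(* Self-loops are cycles of length 1, pairs of parallel edges of length 2. *)
Definition is_cycle (T : {set 'I_N}) (x : V) (p : seq ('I_N * V)) : bool :=
  [&& p != [::], walk x p, last x (unzip2 p) == x,
      all (mem T) (unzip1 p), uniq (unzip1 p) & uniq (unzip2 p)].

(* The length bound makes this decidable and loses nothing: see [acyclicP]. *)
Definition acyclic (T : {set 'I_N}) : bool :=
  [forall k : 'I_N.+1, forall p : k.-tuple ('I_N * V), forall x,
     ~~ is_cycle T x p].

Lemma acyclicP (T : {set 'I_N}) :
  reflect (forall x p, ~~ is_cycle T x p) (acyclic T).
Proof.
apply: (iffP idP) => [acT x p | noc].
  apply/negP => cyc.
  have szp : (size p < N.+1)%N.
    case/and5P: (cyc) => _ _ _ _ /andP[/card_uniqP up _].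
    rewrite ltnS -(size_map fst p) -[size _]up.
    by rewrite -[X in (_ <= X)%N](card_ord N) max_card.
  move/forallP/(_ (Ordinal szp))/forallP/(_ (in_tuple p))/forallP/(_ x): acT.
  by rewrite cyc.
by apply/forallP => k; apply/forallP => p; apply/forallP => x; apply: noc.
Qed.

Definition spanning_tree (T : {set 'I_N}) : bool :=
  connected_sub T && acyclic T.

Definition Psi : {mpoly int[N]} :=
  \sum_(T : {set 'I_N} | spanning_tree T) \prod_(e | e \notin T) 'X_e.

Definition phi : {mpoly int[N]} :=
  \sum_(T : {set 'I_N} | spanning_tree T) \prod_(e in T) 'X_e.

(* The polynomial phi^J_I. Its variables are numbered by the enumeration of the
   edges outside I and J: the k-th one is alpha_e for [e = enum_val k]. *)
Definition phi_sub (J I : {set 'I_N}) : {mpoly int[#|~: (I :|: J)|]} :=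
  \sum_(T : {set 'I_N} | [&& spanning_tree T, J \subset T & [disjoint T & I]])
    \prod_(k < #|~: (I :|: J)| | enum_val k \in T :\: J) 'X_k.

End MultigraphDefs.

Definition nb_zeros (F : finFieldType) (n : nat) (f : {mpoly int[n]}) : nat :=
  #|[set v : {ffun 'I_n -> F} | (map_mpoly intr f).@[v] == 0]|.

(* A prime power q is given through a field F with q elements. The divisions by
   q ^ 2 are exact when nG G >= 2, respectively hG G >= 2. *)
Definition c2 (G : multigraph) (F : finFieldType) : 'Z_#|F| :=
  (nb_zeros F (Psi G) %/ #|F| ^ 2)%N%:R.

Definition c2_dual (G : multigraph) (F : finFieldType) : 'Z_#|F| :=
  (nb_zeros F (phi G) %/ #|F| ^ 2)%N%:R.

Definition duality_admissible (G : multigraph) : Prop :=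
  [/\ log_divergent G, 3 <= hG G, 3 <= nG G &
    forall (F : finFieldType) (I J : {set 'I_(nb_edges G)}),
      [disjoint I & J] ->
      (#|I| < #|J|)%N -> #|J|%:Z <= nG G -> #|I|%:Z <= nG G - 3 ->
      (#|F| ^ 3 %| nb_zeros F (phi_sub J I))%N].

(* Main.v *)
Require Import Defs.
From mathcomp Require Import all_boot all_order all_algebra.
From mathcomp Require Import mpoly.
From mathcomp Require Import perm mxabelem zify ring.

(** Both polynomials extend to (P^1)^N, where the inversion of all coordinates
    exchanges their zero sets.  Sorting the zeros by the set of infinite
    coordinates gives

      sum_J [phi^J]_q = sum_I [Psi^I]_q.

    The terms for the empty set are [phi]_q and [Psi]_q, the terms with more than
    n infinite coordinates agree on both sides, and admissibility kills the other
    terms on the left modulo q^3.  The other terms on the right vanish modulo q^3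
    for every graph: Psi^I is the determinant of a generic diagonal form restricted
    to the cycle space, of dimension h, of a graph with d edges, where d > 2h and
    d >= h + 3.  The number of singular members of such
    a linear system of forms is computed modulo q^3 by the first two moments of
    the number of kernel vectors, and these moments are counted by exchanging the
    roles of forms and vectors. *)

Set Implicit Arguments.
Unset Strict Implicit.
Unset Printing Implicit Defensive.

Import GRing.Theory.
Local Open Scope ring_scope.

(** * Singular members of a linear system of quadratic forms *)

Section SingularForms.

Variable F : finFieldType.
Local Notation q := #|F|.

Lemma card_kermx d k (A : 'M[F]_(d, k)) :
  #|[set v : 'rV_d | v *m A == 0]%R| = (q ^ (d - \rank A))%N.
Proof.
rewrite -mxrank_ker -card_rowg; apply: eq_card => v.
by rewrite !inE sub_kermx.
Qed.

Lemma dvdn_card_kermx d k (A : 'M[F]_(d, k)) (j : nat) :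
  (j + \rank A <= d)%N -> (q ^ j %| #|[set v : 'rV_d | v *m A == 0]%R|)%N.
Proof. by move=> le_jd; rewrite card_kermx dvdn_exp2l // leq_subRL; lia. Qed.

Lemma mul_rV_diagC d (v w : 'rV[F]_d) : v *m diag_mx w = w *m diag_mx v.
Proof. by apply/rowP => j; rewrite !mul_mx_diag !mxE mulrC. Qed.

Lemma card_set_sum (T : finType) (P : pred T) :
  #|[set x | P x]| = (\sum_x P x)%N.
Proof. by rewrite cardsE -sum1_card big_mkcond. Qed.

Lemma natr_Zp_eq0 m k : (1 < m)%N -> ((k%:R : 'Z_m) == 0) = (m %| k)%N.
Proof. by move=> m_gt1; rewrite -val_eqE /= val_Zp_nat. Qed.

Variables (h d : nat) (C : 'M[F]_(h, d)).

(** The Gram matrix of the diagonal form with coefficients [v], pulled back along the rows of [C];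
    it depends linearly on [v]. *)
Definition diag_form (v : 'rV[F]_d) : 'M[F]_h := C *m diag_mx v *m C^T.

Local Notation cond x := (diag_mx (x *m C) *m C^T).

(** This exchanges the roles of form and vector: for fixed [x], being killed by [x] is a linear
    system in [v] with [h] equations. *)
Lemma mul_diag_form (x : 'rV_h) v : x *m diag_form v = v *m cond x.
Proof. by rewrite /diag_form !mulmxA mul_rV_diagC. Qed.

(* The symmetry x M y^T = y M x^T of the forms M saves one of the 2h linear
   conditions on v. *)
Lemma rank_pair_cond (x y : 'rV_h) :
  x != 0 -> (\rank (row_mx (cond x) (cond y)) < h + h)%N.
Proof.
move=> x0; have := @mulmx0_rank_max _ _ _ _ (row_mx (cond x) (cond y))
  (col_mx y^T (- x^T)).
have -> : row_mx (cond x) (cond y) *m col_mx y^T (- x^T) = 0.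
  rewrite mul_row_col mulmxN -!mulmxA -!trmx_mul.
  rewrite -[diag_mx (x *m C)]tr_diag_mx -[diag_mx (y *m C)]tr_diag_mx.
  by rewrite -!trmx_mul mul_rV_diagC subrr.
move/(_ erefl); suff: (0 < \rank (col_mx y^T (- x^T)))%N by lia.
rewrite lt0n mxrank_eq0; apply: contraNneq x0 => yx0.
have: (- x^T) = 0 by have /(congr1 dsubmx) := yx0; rewrite col_mxKd => ->; rewrite linear0.
by move/(congr1 trmx); rewrite linearN /= trmxK trmx0 => /eqP; rewrite oppr_eq0.
Qed.

Definition forms_killing2 (x y : 'rV_h) : {set 'rV[F]_d} :=
  [set v | (x *m diag_form v == 0) && (y *m diag_form v == 0)].

Lemma dvdn_forms_killing2 (x y : 'rV_h) : (h.*2 < d)%N -> x != 0 ->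
  (q ^ 2 %| #|forms_killing2 x y|)%N.
Proof.
move=> hd x0.
have -> : #|forms_killing2 x y| =
    #|[set v : 'rV_d | v *m row_mx (cond x) (cond y) == 0]%R|.
  apply: eq_card => v.
  by rewrite !inE !mul_diag_form mul_mx_row row_mx_eq0.
by apply: dvdn_card_kermx; have := rank_pair_cond y x0; lia.
Qed.

Lemma forms_killing2D (x y : 'rV_h) t :
  forms_killing2 x (y + t *: x) = forms_killing2 x y.
Proof.
apply/setP => v; rewrite !inE; case: eqP => //= xv0.
by rewrite mulmxDl -scalemxAl xv0 scaler0 addr0.
Qed.

(** The summand is invariant under y -> y + t x. As some coordinate x_i is nonzero, these
    translations permute the q slices of constant y_i transitively, which yields the third factor
    q. *)
Lemma sum_forms_killing2 (x : 'rV_h) : (h.*2 < d)%N -> x != 0 ->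
  (q ^ 3 %| \sum_(y : 'rV_h) #|forms_killing2 x y|)%N.
Proof.
move=> hd /rV0Pn [i xi0].
rewrite (partition_big (fun y : 'rV_h => y 0 i) predT) //=.
have shift t : (\sum_(y : 'rV_h | (y 0 i == t)%R) #|forms_killing2 x y| =
    \sum_(y : 'rV_h | (y 0 i == 0)%R) #|forms_killing2 x y|)%N.
  rewrite (reindex_onto (fun y => y + (t / x 0 i) *: x)
     (fun y => y - (t / x 0 i) *: x)) /=; last by move=> y _; rewrite subrK.
  apply: eq_big => y; last by rewrite forms_killing2D.
  by rewrite addrK eqxx andbT !mxE divfK // -subr_eq0 addrK.
rewrite (eq_bigr _ (fun t _ => shift t)) sum_nat_const.
rewrite expnS dvdn_mul ?dvdn_sum //= => y _.
by apply: dvdn_forms_killing2 => //; apply/rV0Pn; exists i.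
Qed.

Lemma card_left_kernel (v : 'rV_d) :
  #|[set x : 'rV_h | x *m diag_form v == 0]%R| = (q ^ (h - \rank (diag_form v)))%N.
Proof. exact: card_kermx. Qed.

(** The first moment: after the exchange of sums, each [x] imposes at most [h] conditions on [v], so
    at least three dimensions remain. *)
Lemma sum_card_left_kernel : (h + 3 <= d)%N ->
  (q ^ 3 %| \sum_(v : 'rV_d) #|[set x : 'rV_h | x *m diag_form v == 0]%R|)%N.
Proof.
move=> hd.
rewrite (eq_bigr (fun v => \sum_(x : 'rV_h) (x *m diag_form v == 0)%R)%N); last first.
  by move=> v _; rewrite card_set_sum.
rewrite exchange_big dvdn_sum //= => x _.
rewrite (_ : \sum_v _ = #|[set v : 'rV_d | v *m cond x == 0]%R|)%N; last first.
  by rewrite card_set_sum; apply: eq_bigr => v _; rewrite mul_diag_form.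
by apply: dvdn_card_kermx; have := rank_leq_col (cond x); lia.
Qed.

Lemma sum_card_left_kernel_sqr : (h + 3 <= d)%N -> (h.*2 < d)%N ->
  (q ^ 3 %| \sum_(v : 'rV_d) #|[set x : 'rV_h | x *m diag_form v == 0]%R| ^ 2)%N.
Proof.
move=> hd hd2.
rewrite (eq_bigr (fun v => \sum_(x : 'rV_h) \sum_(y : 'rV_h)
   ((x *m diag_form v == 0) && (y *m diag_form v == 0))%R)%N); last first.
  move=> v _; rewrite -mulnn card_set_sum big_distrl; apply: eq_bigr => x _.
  by rewrite big_distrr; apply: eq_bigr => y _; rewrite /= mulnb.
(* The pairs with x = 0 contribute the first moment; the rank bound for pairs needs x nonzero. *)
rewrite exchange_big (bigD1 0) //= dvdn_addr; last first.
  under eq_bigr => v _ do under eq_bigr => y _ do rewrite mul0mx eqxx /=.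
  under eq_bigr => v _ do rewrite -card_set_sum.
  exact: sum_card_left_kernel.
apply: dvdn_sum => x x0; rewrite exchange_big /=.
rewrite (eq_bigr (fun y => #|forms_killing2 x y|)) ?sum_forms_killing2 // => y _.
by rewrite card_set_sum.
Qed.

(* With t = q and Y = q^c the cardinal of the kernel of a form of corank c, the
   indicator s of c > 0 is a quadratic polynomial in Y modulo q^3. *)
Lemma corank_indicator (R : comPzRingType) (t : R) c : t ^+ 3 = 0 ->
  (1 - t - t ^+ 2) * (0 < c)%N%:R =
    (t ^+ 2 + t) * t ^+ c - (t ^+ c) ^+ 2 - (t ^+ 2 + t - 1).
Proof.
move=> t3; case: c => [|[|[|c]]] /=; rewrite ?expr0 ?expr1.
- by ring.
- have -> : (t ^+ 2 + t) * t = t ^+ 2 + t ^+ 3 by ring.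
  by rewrite t3; ring.
- have -> : (t ^+ 2 + t) * t ^+ 2 = t ^+ 3 * (t + 1) by ring.
  have -> : (t ^+ 2) ^+ 2 = t ^+ 3 * t by ring.
  by rewrite t3; ring.
- have -> : t ^+ c.+3 = 0 by rewrite -addn3 exprD t3 mulr0.
  by ring.
Qed.

Lemma dvdn_card_singular_forms : (h + 3 <= d)%N -> (h.*2 < d)%N ->
  (q ^ 3 %| #|[set v : 'rV_d | \det (diag_form v) == 0]%R|)%N.
Proof.
move=> hd hd2; have q_gt1 : (1 < q)%N := card_finNzRing_gt1 F.
have q3 : (1 < q ^ 3)%N by rewrite -[1%N](exp1n 3) ltn_exp2r.
pose t : 'Z_(q ^ 3) := q%:R.
have t3 : t ^+ 3 = 0 by rewrite -natrX pchar_Zp.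
rewrite -natr_Zp_eq0 //.
(* A form is singular iff its corank is positive; summing this identity over all forms expresses
   their number through the two moments. *)
have key (v : 'rV_d) : (1 - t - t ^+ 2) * (\det (diag_form v) == 0)%:R =
   (t ^+ 2 + t) * #|[set x : 'rV_h | x *m diag_form v == 0]%R|%:R
   - (#|[set x : 'rV_h | x *m diag_form v == 0]%R| ^ 2)%:R - (t ^+ 2 + t - 1).
  rewrite card_left_kernel !natrX -/t -corank_indicator //.
  congr (_ * (nat_of_bool _)%:R); rewrite subn_gt0.
  by rewrite ltn_neqAle rank_leq_row andbT -/(row_free _) row_free_unit unitmxE
             unitfE negbK.
have : (1 - t - t ^+ 2) * #|[set v : 'rV_d | \det (diag_form v) == 0]%R|%:R = 0.
  rewrite card_set_sum natr_sum mulr_sumr (eq_bigr _ (fun v _ => key v)).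
  rewrite 2!sumrB -mulr_sumr -!natr_sum.
  move: (sum_card_left_kernel hd) (sum_card_left_kernel_sqr hd hd2).
  rewrite -!natr_Zp_eq0 // => /eqP -> /eqP ->.
  (* The constant term is summed over q^d forms, and d >= 3. *)
  rewrite sumr_const card_mx mul1n mulr0 subrr sub0r -mulr_natr natrX.
  have -> : (q%:R : 'Z_(q ^ 3)) ^+ d = 0.
    by rewrite -/t -(subnK (_ : 3 <= d)%N) ?exprD ?t3 ?mulr0 //; lia.
  by rewrite mulr0 oppr0.
(* 1 + t + 2 t^2 is the inverse of 1 - t - t^2 modulo t^3. *)
move/(congr1 ( *%R (1 + t + 2 * t ^+ 2))); rewrite mulr0 mulrA.
have -> : (1 + t + 2 * t ^+ 2) * (1 - t - t ^+ 2) = 1 - t ^+ 3 * (3 + 2 * t) by ring.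
by rewrite t3 mul0r subr0 mul1r => ->.
Qed.

End SingularForms.

(** * The matrix-tree theorem *)

Section Connectivity.

Variable G : multigraph.
Local Notation V := (vertex G).
Local Notation N := (nb_edges G).
Implicit Types (T : {set 'I_N}) (x y : V) (e f : 'I_N).

Lemma joins_sym e x y : joins e x y = joins e y x.
Proof. by rewrite /joins orbC. Qed.

Lemma connect_adjC T x y : connect (adj T) x y = connect (adj T) y x.
Proof.
by apply: sym_connect_sym => a b; apply: eq_existsb => e; rewrite joins_sym.
Qed.

Lemma connect_joins T e x y : e \in T -> joins e x y -> connect (adj T) x y.
Proof. by move=> eT exy; apply/connect1/existsP; exists e; rewrite eT. Qed.

Lemma walk_connect T x p :
  walk x p -> all (mem T) (unzip1 p) -> connect (adj T) x (last x (unzip2 p)).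
Proof.
elim: p x => [|[e y] p IHp] x //= /andP[exy wp] /andP[eT pT].
exact: connect_trans (connect_joins eT exy) (IHp y wp pT).
Qed.

Lemma walk_ends x p e : walk x p -> e \in unzip1 p ->
  ((ends e).1 \in x :: unzip2 p) && ((ends e).2 \in x :: unzip2 p).
Proof.
elim: p x => [|[f y] p IHp] x //= /andP[fxy wp].
rewrite inE => /predU1P[-> | ep].
  by case/orP: fxy => /eqP ->; rewrite !inE !eqxx ?orbT.
by have /andP[e1 e2] := IHp y wp ep; rewrite [_ \in _]inE e1 orbT inE e2 orbT.
Qed.

Lemma path_walk T x p : path (adj T) x p -> uniq (x :: p) ->
  exists w, [/\ walk x w, unzip2 w = p, all (mem T) (unzip1 w) & uniq (unzip1 w)].
Proof.
elim: p x => [|y p IHp] x /=; first by exists [::].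
case/andP=> /existsP[e /andP[eT exy]] py /andP[xp up].
have [w [ww wp wT uw]] := IHp y py up.
exists ((e, y) :: w); split => /=; rewrite ?exy ?wp ?eT // uw andbT.
(* If [e] occurred again, its end [x] would lie on the rest of the path. *)
apply: contra xp => /(walk_ends ww); rewrite wp => /andP[e1 e2].
by case/orP: exy => /eqP exy; rewrite exy in e1 e2.
Qed.

(** The first edge of a cycle can be bypassed along the rest of the cycle. *)
Lemma cyclic_removable_edge T : connected_sub T -> ~~ acyclic T ->
  exists2 e, e \in T & connected_sub (T :\ e).
Proof.
move=> conT /forallPn[k /forallPn[p /forallPn[x]]]; rewrite negbK.
case: {k p}(tval p) => [|[e y] p] // /and5P[_ /= /andP[exy wp] /eqP lp /andP[eT pT]].
case/andP=> /andP[ep _] _; exists e => //.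
have cyx : connect (adj (T :\ e)) y x.
  rewrite -lp; apply: walk_connect wp _; apply/allP => f fp.
  have fT : f \in T := allP pT f fp.
  by rewrite !inE fT andbT; apply: contraNneq ep => <-.
apply/forallP => a; apply/forallP => b.
move: (forallP (forallP conT a) b); apply: connect_sub => {}a {}b.
case/existsP=> f /andP[fT fab]; have [fe | nfe] := eqVneq f e; last first.
  by apply: connect_joins fab; rewrite !inE nfe.
rewrite {f}fe in fT fab *.
have [] : (a = x /\ b = y) \/ (a = y /\ b = x).
  by case/orP: exy => /eqP exy; case/orP: fab; rewrite exy => /eqP[-> ->]; auto.
  by case=> -> ->; rewrite connect_adjC.
by case=> -> ->.
Qed.

(** A simple path avoiding [e] between the ends of [e] closes up with [e] to a cycle; for a
    self-loop this path is empty. *)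
Lemma removable_edge_cyclic T e :
  e \in T -> connected_sub (T :\ e) -> ~~ acyclic T.
Proof.
move=> eT; case Exy: (ends e) => [x y] conTe; apply/negP => /acyclicP acT.
have /connectP[p0 p0P xlast] := forallP (forallP conTe y) x.
case/shortenP: p0P xlast => p pP up _ xlast.
have [w [ww wp wT uw]] := path_walk pP up.
have /negP[] := acT x ((e, y) :: w).
apply/and5P; split; rewrite /= ?wp -?xlast ?eqxx //.
- by rewrite /joins Exy eqxx.
- by rewrite eT; apply/allP => f /(allP wT) /setD1P[].
move: up => /= ->; rewrite uw !andbT; apply: contraT; rewrite negbK => /(allP wT).
by rewrite /= !inE eqxx.
Qed.

Lemma spanning_tree_min T e :
  spanning_tree T -> e \in T -> ~~ connected_sub (T :\ e).
Proof.
by case/andP=> _ acT eT; apply: contraL acT; apply: removable_edge_cyclic.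
Qed.

End Connectivity.

(** * Reduced incidence matrix and its bordered determinant *)

Section MatrixTree.

Variables (G : multigraph) (r : vertex G).
Local Notation V := (vertex G).
Local Notation N := (nb_edges G).
Local Notation n := #|[set~ r]|.
Implicit Types (T : {set 'I_N}) (x y : V) (e f : 'I_N).

Section Incidence.

Variable R : comNzRingType.

(** Omitting the coordinate of the root [r] sends the root to 0 and makes [incidence] the reduced
    incidence matrix. *)
Definition vertex_row x : 'rV[R]_n := \row_j (x == enum_val j)%:R.

Definition incidence : 'M[R]_(N, n) :=
  \matrix_e (vertex_row (ends e).1 - vertex_row (ends e).2).

Lemma vertex_row_root : vertex_row r = 0.
Proof.
apply/rowP => j; rewrite !mxE; case: eqP => // rj.
by have := enum_valP j; rewrite -rj !inE eqxx.
Qed.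

Lemma vertex_row_enum_val j : vertex_row (enum_val j) = delta_mx 0 j.
Proof.
by apply/rowP => k; rewrite !mxE (inj_eq enum_val_inj) eqxx eq_sym.
Qed.

Lemma vertex_row_mul (g : V -> R) x : g r = 0 ->
  vertex_row x *m (\col_j g (enum_val j)) = (g x)%:M.
Proof.
move=> gr; apply/matrixP => i k; rewrite !ord1 !mxE mulr1n.
have [-> | xr] := eqVneq x r.
  by rewrite gr big1 // => j _; rewrite vertex_row_root mxE mul0r.
have xS : x \in [set~ r] by rewrite !inE.
rewrite -[in RHS](enum_rankK_in xS xS) -{1}(enum_rankK_in xS xS).
rewrite vertex_row_enum_val (bigD1 (enum_rank_in xS x)) //= !mxE !eqxx mul1r.
by rewrite big1 ?addr0 // => j jx; rewrite !mxE (negPf jx) andbF mul0r.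
Qed.

(** The edge rows, with signs for their orientation, telescope along a path from [x] to [y]. *)
Lemma connect_row_span T x y : connect (adj T) x y ->
  exists2 a : 'rV[R]_N, (forall e, e \notin T -> a 0 e = 0) &
    a *m incidence = vertex_row x - vertex_row y.
Proof.
case/connectP=> p; elim: p x => [|z p IHp] x /=.
  by move=> _ ->; exists 0 => [e _|]; rewrite ?mxE // mul0mx subrr.
case/andP=> /existsP[e /andP[eT exz]] pP ylast.
have [a aT Ea] := IHp z pP ylast.
have [c Ec] : exists c : R, c *: row e incidence = vertex_row x - vertex_row z.
  case/orP: exz => /eqP ex; [exists 1 | exists (-1)]; rewrite rowK ex.
    by rewrite scale1r.
  by rewrite scaleN1r opprB.
exists (c *: delta_mx 0 e + a) => [f fT|].
  rewrite !mxE aT // addr0; case: (eqVneq f e) fT => [-> | _ _].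
    by rewrite eT.
  by rewrite andbF mulr0.
by rewrite mulmxDl -scalemxAl -rowE Ec Ea addrA subrK.
Qed.

(** Row [j] of the inverse is a path in [T] from the [j]-th vertex to the root. This works over any
    ring, in particular over the integers. *)
Lemma connected_left_inverse T : connected_sub T ->
  exists2 P : 'M[R]_(n, N), (forall j e, e \notin T -> P j e = 0) &
    P *m incidence = 1%:M.
Proof.
move=> conT.
have /fin_all_exists[a aP] (j : 'I_n) : exists a : 'rV[R]_N,
    (forall e, e \notin T -> a 0 e = 0) /\ a *m incidence = delta_mx 0 j.
  have [a aT Ea] := connect_row_span (forallP (forallP conT (enum_val j)) r).
  by exists a; split; rewrite // Ea vertex_row_root subr0 vertex_row_enum_val.
exists (\matrix_j a j) => [j e eT|]; first by rewrite mxE; apply: (aP j).1.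
by apply/row_matrixP => j; rewrite row_mul rowK (aP j).2 row1.
Qed.

Lemma connected_potential0 T (z : 'cV[R]_n) : connected_sub T ->
  (forall e, e \in T -> (incidence *m z) e 0 = 0) -> z = 0.
Proof.
case/connected_left_inverse => P PT PE zT.
rewrite -[z]mul1mx -PE -mulmxA; apply/matrixP => j k; rewrite ord1 !mxE.
apply: big1 => e _; have [eT | eT] := boolP (e \in T).
  by rewrite zT ?mulr0.
by rewrite PT ?mul0r.
Qed.

Lemma disconnected_potential T : ~~ connected_sub T ->
  exists2 z : 'cV[R]_n, z != 0 & forall e, e \in T -> (incidence *m z) e 0 = 0.
Proof.
move=> disT.
have [x xr] : exists x, ~~ connect (adj T) x r.
  apply/existsP; apply: contraR disT; rewrite negb_exists => /forallP con.
  apply/forallP => x; apply/forallP => y.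
  have := con x; have := con y; rewrite !negbK (connect_adjC T y) => ry xr.
  exact: connect_trans xr ry.
(* The potential is the indicator of a component that misses the root. *)
pose g y : R := (connect (adj T) x y)%:R.
have gr : g r = 0 by rewrite /g (negPf xr).
exists (\col_j g (enum_val j)) => [|e eT].
  apply: contraTneq isT => /(congr1 (mulmx (vertex_row x))).
  rewrite vertex_row_mul // mulmx0 /g connect0 => /matrixP/(_ 0 0)/eqP.
  by rewrite !mxE eqxx oner_eq0.
have <- : row e (incidence *m (\col_j g (enum_val j))) 0 0 =
  (incidence *m (\col_j g (enum_val j))) e 0 by rewrite mxE.
rewrite row_mul rowK mulmxBl !vertex_row_mul // !mxE !eqxx !mulr1n /g.
suff -> : connect (adj T) x (ends e).1 = connect (adj T) x (ends e).2 by rewrite subrr.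
have c12 : connect (adj T) (ends e).1 (ends e).2.
  by apply: connect_joins eT _; rewrite /joins -surjective_pairing eqxx.
apply/idP/idP => /connect_trans; apply; rewrite // connect_adjC //.
Qed.

(* (u_e : w_e) are homogeneous coordinates of the variable of the edge e. *)
Definition kirchhoff (u w : 'rV[R]_N) : 'M[R]_(N + n) :=
  block_mx (diag_mx u) (diag_mx w *m incidence) (- incidence^T) 0.

Definition indicator T : 'rV[R]_N := \row_e (e \in T)%:R.

(** The row of an edge [e] is linear in the pair (u_e, w_e). Multilinearity expands the determinant
    over the set [T] of edges for which the [w] part is chosen. *)
Lemma det_kirchhoff_expand u w : \det (kirchhoff u w) =
  \sum_(T : {set 'I_N}) (\prod_e (if e \in T then w 0 e else u 0 e)) *
         \det (kirchhoff (indicator (~: T)) (indicator T)).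
Proof.
pose X (e : 'I_N) (k : 'I_(N + n)) : R := row_mx 1%:M 0 e k.
pose Y (e : 'I_N) (k : 'I_(N + n)) : R := row_mx 0 incidence e k.
have rowE u' w' e k : kirchhoff u' w' (lshift n e) k = w' 0 e * Y e k + u' 0 e * X e k.
  rewrite /kirchhoff block_mxEh /X /Y; case: (split_ordP k) => j ->.
    rewrite !row_mxEl !col_mxEu !mxE mulr0 add0r.
    by case: eqP => [->|_]; rewrite ?mulr1 ?mulr0 ?mulr1n ?mulr0n.
  by rewrite !row_mxEr !col_mxEu mul_diag_mx !mxE mulr0 addr0.
have rowD u' w' i k : kirchhoff u' w' (rshift N i) k = kirchhoff u w (rshift N i) k.
  by rewrite /kirchhoff !block_mxEv !col_mxEd.
have prodE (s : 'S_(N + n)) : \prod_i kirchhoff u w i (s i) =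
  \sum_(T : {set 'I_N}) (\prod_e (if e \in T then w 0 e else u 0 e)) *
     \prod_i kirchhoff (indicator (~: T)) (indicator T) i (s i).
  rewrite big_split_ord /=; under eq_bigr => e _ do rewrite rowE.
  rewrite bigA_distr big_distrl /=; apply: eq_bigr => T _.
  rewrite big_split_ord /= mulrA -big_split /=; congr (_ * _); last first.
    by apply: eq_bigr => i _; rewrite rowD.
  apply: eq_bigr => e _; rewrite rowE !mxE !inE.
  by case: (e \in T); rewrite ?mul1r ?mul0r ?addr0 ?add0r.
rewrite /determinant; under eq_bigr => s _ do rewrite prodE mulr_sumr.
rewrite exchange_big /=; apply: eq_bigr => T _; rewrite mulr_sumr.
by apply: eq_bigr => s _; rewrite mulrCA.
Qed.

(* The middle factor is a signed permutation matrix, of determinant 1 since it is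
   the product of three unipotent block matrices. *)
Lemma det_kirchhoff_minor T (f : 'I_n -> 'I_N) : injective f ->
  [set f i | i : 'I_n] = T ->
  \det (kirchhoff (indicator (~: T)) (indicator T)) =
    \det (rowsub f incidence) ^+ 2.
Proof.
move=> f_inj fT; pose S : 'M[R]_(n, N) := rowsub f 1%:M.
pose D := diag_mx (indicator T).
have SE m (A : 'M[R]_(N, m)) : S *m A = rowsub f A by rewrite mul_rowsub_mx mul1mx.
have SS : S *m S^T = 1%:M.
  by apply/matrixP => i j; rewrite SE !mxE (inj_eq f_inj) eq_sym.
have DE : S^T *m S = D.
  apply/matrixP => e e'; rewrite !mxE -fT; under eq_bigr => i _ do rewrite !mxE.
  have [/imsetP[i _ ->] | eT] := boolP (e \in _).
    rewrite (bigD1 i) //= eqxx mul1r big1 ?addr0 ?mulr1n //.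
    by move=> j ji; rewrite (inj_eq f_inj) (negPf ji) mul0r.
  rewrite mul0rn big1 // => i _; case: eqP eT => [<-|]; last by rewrite mul0r.
  by rewrite imset_f.
have DC : diag_mx (indicator (~: T)) = 1%:M - D.
  apply/matrixP => e e'; rewrite !mxE !inE.
  by case: (e \in T); case: (e == e'); rewrite ?mulr1n ?mulr0n ?subrr ?subr0.
pose A := rowsub f incidence.
have EA : A = S *m incidence by rewrite SE.
have CS : (1%:M - D) *m S^T = 0.
  by rewrite -DE mulmxBl mul1mx -mulmxA SS mulmx1 subrr.
have DD : (1%:M - D) *m (1%:M - D) = 1%:M - D.
  by rewrite -{2}DE mulmxBr mulmx1 mulmxA CS mul0mx subr0.
pose L := block_mx 1%:M S^T 0 (1%:M : 'M[R]_n).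
pose K := block_mx (1%:M : 'M[R]_N) 0 (- S) 1%:M.
have LKL : L *m K *m L = block_mx (1%:M - D) S^T (- S) 0.
  rewrite /L /K !mulmx_block.
  rewrite !(mul1mx, mulmx1, mul0mx, mulmx0, addr0, add0r, mulNmx, mulmxN).
  by rewrite DE SS CS add0r addNr.
have -> : kirchhoff (indicator (~: T)) (indicator T) =
   block_mx 1%:M 0 (- incidence^T *m (1%:M - D)) A^T *m (L *m K *m L) *m
   block_mx 1%:M 0 0 A.
  rewrite LKL /kirchhoff -/D DC !mulmx_block.
  rewrite !(mul1mx, mulmx1, mul0mx, mulmx0, addr0, add0r).
  rewrite -!mulmxA DD [_ *m (S^T *m A)]mulmxA CS mul0mx mulmx0 EA.
  rewrite mulmxA DE trmx_mul mulmxN -mulmxA DE mulNmx -opprD -mulmxDr subrK.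
  by rewrite mulmx1.
rewrite /L /K !det_mulmx !det_lblock !det_ublock !det1 det_tr.
by rewrite !mul1r !mulr1 expr2.
Qed.

Lemma rowsub_enum_val_mul T m (A : 'M[R]_(N, m)) (a : 'rV_N) :
  (forall e, e \notin T -> a 0 e = 0) ->
  (\row_k a 0 (enum_val k)) *m rowsub (enum_val : 'I_#|T| -> 'I_N) A = a *m A.
Proof.
move=> aT; apply/rowP => j; rewrite !mxE.
rewrite [RHS](bigID (mem T)) /= [X in _ = _ + X]big1 ?addr0; last first.
  by move=> e eT; rewrite aT ?mul0r.
by rewrite [RHS]big_enum_val /=; apply: eq_bigr => k _; rewrite !mxE.
Qed.

End Incidence.

Section SpanningTrees.

Variable F : fieldType.

Lemma card_spanning_tree T : spanning_tree T -> #|T| = n.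
Proof.
move=> stT; have /andP[conT acT] := stT; apply/eqP; rewrite eqn_leq.
apply/andP; split; last first.
  have [P PT PE] := connected_left_inverse rat conT.
  pose Q : 'M[rat]_(n, #|T|) := \matrix_(j, k) P j (enum_val k).
  suff /mulmx1_min : Q *m rowsub (enum_val : 'I_#|T| -> 'I_N) (incidence rat) = 1%:M by [].
  apply/row_matrixP => j; rewrite -PE !row_mul -(rowsub_enum_val_mul (T := T)).
    by congr (_ *m _); apply/rowP => k; rewrite !mxE.
  by move=> e eT; rewrite mxE PT.
rewrite leqNgt; apply/negP => ltnT.
pose A := rowsub (enum_val : 'I_#|T| -> 'I_N) (incidence rat).
have [y y0 yA] : exists2 y : 'rV_#|T|, y != 0 & y *m A = 0.
  have: kermx A != 0.
    rewrite -mxrank_eq0 mxrank_ker -lt0n subn_gt0.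
    exact: leq_ltn_trans (rank_leq_col A) ltnT.
  case/rowV0Pn => y /sub_kermxP yA y0; by exists y.
have /rV0Pn[k yk] := y0.
set e := enum_val k; have eT : e \in T := enum_valP k.
(* Removing [e] disconnects the tree, so some nonzero potential is constant along all other edges of
   [T]. The relation [y] forces this along [e] too, against the connectedness of [T]. *)
have := spanning_tree_min stT eT.
case/(disconnected_potential rat) => z /eqP z0 zTe; apply: z0.
apply: (connected_potential0 conT) => f fT.
have [-> | fe] := eqVneq f e; last by apply: zTe; rewrite !inE fe.
have : (y *m A *m z) 0 0 = y 0 k * (incidence rat *m z) e 0.
  rewrite -mulmxA mxE (bigD1 k) //= big1 ?addr0.
    by rewrite mul_rowsub_mx !mxE.
  move=> l lk; rewrite mul_rowsub_mx [X in _ * X]mxE zTe ?mulr0 //.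
  by rewrite !inE enum_valP andbT (inj_eq enum_val_inj).
by rewrite yA mul0mx mxE => /esym/eqP; rewrite mulf_eq0 (negPf yk) => /eqP.
Qed.

(** The determinant is the square of a minor. Over the integers this minor is invertible, by the
    left inverse supported on [T], hence it is 1 or -1. *)
Lemma det_kirchhoff_tree T : spanning_tree T ->
  \det (kirchhoff (indicator F (~: T)) (indicator F T)) = 1.
Proof.
move=> stT; have /andP[conT _] := stT; have cT := card_spanning_tree stT.
pose f (i : 'I_n) : 'I_N := enum_val (cast_ord (esym cT) i).
have f_inj : injective f by move=> i j /enum_val_inj/cast_ord_inj.
have fT : [set f i | i : 'I_n] = T.
  apply/setP => e; apply/imsetP/idP => [[i _ ->] | eT]; first exact: enum_valP.
  exists (cast_ord cT (enum_rank_in eT e)) => //.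
  by rewrite /f cast_ordK enum_rankK_in.
rewrite (det_kirchhoff_minor _ f_inj fT).
have -> : rowsub f (incidence F) = map_mx intr (rowsub f (incidence int)).
  by apply/matrixP => i j; rewrite !mxE rmorphB /= !rmorph_nat.
rewrite det_map_mx -rmorphXn /=.
have [P PT PE] := connected_left_inverse int conT.
have /(congr1 determinant) : colsub f P *m rowsub f (incidence int) = 1%:M.
  rewrite -PE; apply/matrixP => i j; rewrite !mxE.
  rewrite [RHS](bigID (mem T)) /= [X in _ = _ + X]big1 ?addr0; last first.
    by move=> e eT; rewrite PT ?mul0r.
  rewrite [RHS]big_enum_val /= (reindex (cast_ord cT)) /=.
    by apply: eq_bigr => k _; rewrite !mxE /f cast_ordK.
  by exists (cast_ord (esym cT)) => k _; rewrite ?cast_ordK ?cast_ordKV.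
rewrite det_mulmx det1 => PA1.
have : \det (rowsub f (incidence int)) \is a GRing.unit.
  by apply/unitrPr; exists (\det (colsub f P)); rewrite mulrC.
by rewrite qualifE => /pred2P[] ->.
Qed.

(** A nonzero left kernel vector comes from a cycle in [T] if [T] is connected, and otherwise from a
    potential that is constant along the edges of [T]. *)
Lemma det_kirchhoff_nontree T : ~~ spanning_tree T ->
  \det (kirchhoff (indicator F (~: T)) (indicator F T)) = 0.
Proof.
move=> ntT; apply/eqP/det0P.
have mask (a : 'rV[F]_N) S e : (a *m diag_mx (indicator F S)) 0 e =
    if e \in S then a 0 e else 0.
  by rewrite mul_mx_diag !mxE; case: ifP; rewrite ?mulr1 ?mulr0.
have [conT | disT] := boolP (connected_sub T).
  have [e eT conTe] : exists2 e, e \in T & connected_sub (T :\ e).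
    by apply: cyclic_removable_edge; rewrite // /spanning_tree conT in ntT *.
  have [a aT Ea] := connect_row_span F (forallP (forallP conTe (ends e).1) (ends e).2).
  pose x : 'rV[F]_N := delta_mx 0 e - a.
  have xT f : f \notin T -> x 0 f = 0.
    move=> fT; rewrite !mxE aT; last by rewrite !inE (negPf fT) andbF.
    by rewrite (negPf (_ : f != e)) ?andbF ?subr0 //; apply: contraNneq fT => ->.
  have x0 : x != 0.
    apply/rV0Pn; exists e; rewrite !mxE aT ?subr0 ?eqxx ?oner_eq0 //.
    by rewrite !inE eqxx.
  exists (row_mx x 0).
    by apply: contraNneq x0 => /(congr1 lsubmx); rewrite row_mxKl linear0 => ->.
  rewrite mul_row_block !mul0mx !addr0 mulmxA.
  have -> : x *m diag_mx (indicator F T) = x.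
    by apply/rowP => f; rewrite mask; case: ifPn => // /xT ->.
  have -> : x *m diag_mx (indicator F (~: T)) = 0.
    by apply/rowP => f; rewrite mask in_setC [RHS]mxE; case: ifPn => // /xT ->.
  by rewrite mulmxBl Ea -rowE rowK subrr row_mx0.
have [z z0 zT] := disconnected_potential F disT.
pose x : 'rV[F]_N := (incidence F *m z)^T.
have xT f : f \in T -> x 0 f = 0 by move=> fT; rewrite mxE zT.
exists (row_mx x z^T).
  apply: contraNneq z0 => /(congr1 rsubmx); rewrite row_mxKr linear0.
  by move/(congr1 trmx); rewrite trmxK trmx0 => ->.
rewrite mul_row_block mulmx0 addr0 mulmxA mulmxN -trmx_mul.
have -> : x *m diag_mx (indicator F T) = 0.
  by apply/rowP => f; rewrite mask [RHS]mxE; case: ifPn => // /xT ->.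
have -> : x *m diag_mx (indicator F (~: T)) = x.
  by apply/rowP => f; rewrite mask in_setC; case: ifPn => //; rewrite negbK => /xT ->.
by rewrite subrr mul0mx row_mx0.
Qed.

(** The common homogenization of both graph polynomials: u = 1 gives the dual one in [w], and w = 1
    the usual one in [u]. *)
Definition tree_sum (u w : 'I_N -> F) : F :=
  \sum_(T : {set 'I_N} | spanning_tree T) \prod_e (if e \in T then w e else u e).

Lemma det_kirchhoff (u w : 'I_N -> F) :
  \det (kirchhoff (\row_e u e) (\row_e w e)) = tree_sum u w.
Proof.
rewrite det_kirchhoff_expand /tree_sum [RHS]big_mkcond; apply: eq_bigr => T _.
have [stT | ntT] := boolP (spanning_tree T); last first.
  by rewrite det_kirchhoff_nontree ?mulr0.
rewrite det_kirchhoff_tree // mulr1; apply: eq_bigr => e _.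
by rewrite !mxE.
Qed.

End SpanningTrees.
End MatrixTree.

(** * Zeros on the product of projective lines *)

Section PartialInverse.

Variables (k m : nat) (f : 'I_k -> 'I_m).

Definition pinv (e : 'I_m) : option 'I_k := [pick i | f i == e].

Lemma pinvK i : injective f -> pinv (f i) = Some i.
Proof.
move=> f_inj; rewrite /pinv; case: pickP => [j /eqP/f_inj -> // | /(_ i)].
by rewrite eqxx.
Qed.

Lemma pinv_notin e : e \notin [set f i | i : 'I_k] -> pinv e = None.
Proof.
move=> ef; rewrite /pinv; case: pickP => // i /eqP fi.
by rewrite -fi imset_f in ef.
Qed.

Lemma big_imset_split (R : comPzSemiRingType) (g : 'I_m -> R) : injective f ->
  \prod_e g e = \prod_i g (f i) * \prod_(e | e \notin [set f i | i : 'I_k]) g e.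
Proof.
move=> f_inj; rewrite (bigID (mem [set f i | i : 'I_k])) /=; congr (_ * _).
by rewrite big_imset //= => i j _ _; apply: f_inj.
Qed.

Lemma sum_imset_split (R : nmodType) (g : 'I_m -> R) : injective f ->
  \sum_e g e = \sum_i g (f i) + \sum_(e | e \notin [set f i | i : 'I_k]) g e.
Proof.
move=> f_inj; rewrite (bigID (mem [set f i | i : 'I_k])) /=; congr (_ + _).
by rewrite big_imset //= => i j _ _; apply: f_inj.
Qed.

End PartialInverse.

Section ProjectivePoints.

Variables (G : multigraph) (F : finFieldType).
Local Notation N := (nb_edges G).
Local Notation q := #|F|.
Implicit Types (T J : {set 'I_N}) (p : {ffun 'I_N -> option F}).

(* [option F] is the projective line, [None] its point at infinity, and
   (num o : den o) are homogeneous coordinates of o. *)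
Definition num (o : option F) : F := if o is Some x then x else 1.
Definition den (o : option F) : F := if o is Some _ then 1 else 0.

Definition poles p : {set 'I_N} := [set e | p e == None].

Definition phi_hom p : F := tree_sum (den \o p) (num \o p).
Definition psi_hom p : F := tree_sum (num \o p) (den \o p).

Definition proj_inv (o : option F) : option F :=
  if o is Some x then (if x == 0 then None else Some x^-1) else Some 0.

Lemma proj_invK : involutive proj_inv.
Proof.
case=> [x|] /=; last by rewrite eqxx.
by case: eqVneq => [-> //| x0] /=; rewrite invr_eq0 (negPf x0) invrK.
Qed.

Lemma proj_inv_coord o : exists c, [/\ c != 0, num (proj_inv o) = c * den o &
  den (proj_inv o) = c * num o].
Proof.
case: o => [x|] /=; last by exists 1; rewrite oner_eq0 !mul1r.
case: eqVneq => [-> | x0] /=; first by exists 1; rewrite oner_eq0 !mul1r.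
by exists x^-1; rewrite invr_eq0 mulr1 mulVf.
Qed.

Definition point_inv p : {ffun 'I_N -> option F} := [ffun e => proj_inv (p e)].

(** Inversion swaps the two homogeneous coordinates of each edge up to a nonzero scalar, and
    [tree_sum] is homogeneous in each pair. *)
Lemma phi_hom_inv p : (phi_hom (point_inv p) == 0) = (psi_hom p == 0).
Proof.
have /fin_all_exists[c cP] e := proj_inv_coord (p e).
suff -> : phi_hom (point_inv p) = (\prod_e c e) * psi_hom p.
  rewrite mulf_eq0; case: eqP => //= /eqP; rewrite prodf_seq_eq0 => /hasP[e _] /=.
  by have [/negPf -> ] := cP e.
rewrite /phi_hom /psi_hom /tree_sum mulr_sumr; apply: eq_bigr => T _.
rewrite -big_split; apply: eq_bigr => e _ /=; rewrite ffunE.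
by have [_ -> ->] := cP e; case: ifP.
Qed.

Lemma card_phi_psi_hom :
  #|[set p | phi_hom p == 0]| = #|[set p | psi_hom p == 0]|.
Proof.
have invK : involutive point_inv.
  by move=> p; apply/ffunP => e; rewrite !ffunE proj_invK.
rewrite -(card_imset _ (inv_inj invK)); apply: eq_card => p.
rewrite !inE -phi_hom_inv; apply/imsetP/idP => [[p' + ->] | p0].
  by rewrite inE invK.
by exists (point_inv p); rewrite ?invK // inE.
Qed.

Lemma card_by_poles (Q : pred {ffun 'I_N -> option F}) :
  #|[set p | Q p]| = (\sum_J #|[set p | (poles p == J) && Q p]|)%N.
Proof.
rewrite cardsE -sum1_card (partition_big poles predT) //=; apply: eq_bigr => J _.
rewrite -sum1_card; apply: eq_bigl => p; rewrite inE andbC //.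
Qed.

Section Chart.

Variables (k : nat) (f : 'I_k -> 'I_N).
Hypothesis f_inj : injective f.
Local Notation im := [set f i | i : 'I_k].

(** The affine cell of the points whose infinite coordinates are exactly those outside the image of
    [f]. *)
Definition chart (v : {ffun 'I_k -> F}) : {ffun 'I_N -> option F} :=
  [ffun e => omap v (pinv f e)].

Lemma chart_im v i : chart v (f i) = Some (v i).
Proof. by rewrite ffunE pinvK. Qed.

Lemma chart_notin v e : e \notin im -> chart v e = None.
Proof. by move=> ef; rewrite ffunE pinv_notin. Qed.

Lemma card_chart (Q : pred {ffun 'I_N -> option F}) :
  #|[set v | Q (chart v)]| = #|[set p | (poles p == ~: im) && Q p]|.
Proof.
have chart_inj : injective chart.
  move=> v w vw; apply/ffunP => i; apply: Some_inj.
  by rewrite -!chart_im vw.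
rewrite -(card_imset _ chart_inj); apply: eq_card => p.
rewrite inE; apply/imsetP/andP => [[v + ->] | [/eqP pP Qp]].
  rewrite inE => Qv; split=> //; apply/eqP/setP => e; rewrite !inE.
  have [/imsetP[i _ ->] | ef] := boolP (e \in im); first by rewrite chart_im.
  by rewrite chart_notin.
have pE : chart [ffun i => num (p (f i))] = p.
  apply/ffunP => e; have [/imsetP[i _ ->] | ef] := boolP (e \in im).
    rewrite chart_im ffunE; have : f i \notin poles p by rewrite pP inE negbK imset_f.
    by rewrite inE; case: (p (f i)).
  rewrite chart_notin //; apply/esym/eqP.
  by move: ef; rewrite -in_setC -pP inE.
by exists [ffun i => num (p (f i))]; rewrite ?inE pE.
Qed.

(** Keeping [a] and [b] abstract serves both polynomials: they are [den] and [num], and for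
    [psi_hom] the set [T] becomes the complement of the tree. *)
Lemma prod_chart (a b : option F -> F) v : a None = 0 -> b None = 1 ->
  forall T, \prod_e (if e \in T then b (chart v e) else a (chart v e)) =
   if ~: im \subset T then \prod_i (if f i \in T then b (Some (v i)) else a (Some (v i)))
   else 0.
Proof.
move=> a0 b1 T; rewrite (big_imset_split _ f_inj).
under eq_bigr => i _ do rewrite chart_im.
case: ifPn => [/subsetP sT | /subsetPn[e]].
  rewrite [X in _ * X]big1 ?mulr1 // => e ef.
  by rewrite chart_notin // b1 sT // inE.
rewrite inE => ef eT; rewrite [X in _ * X](bigD1 e) //= chart_notin // a0.
by rewrite (negPf eT) mul0r mulr0.
Qed.

Lemma phi_hom_chart v : phi_hom (chart v) =
  \sum_(T | spanning_tree T && (~: im \subset T)) \prod_(i | f i \in T) v i.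
Proof.
rewrite /phi_hom /tree_sum [RHS]big_mkcondr /=; apply: eq_bigr => T _.
by rewrite prod_chart // [in RHS]big_mkcond.
Qed.

Lemma psi_hom_chart v : psi_hom (chart v) =
  \sum_(T | spanning_tree T && (~: im \subset ~: T)) \prod_(i | f i \notin T) v i.
Proof.
rewrite /psi_hom /tree_sum [RHS]big_mkcondr /=; apply: eq_bigr => T _.
rewrite (eq_bigr (fun e => if e \in ~: T then num (chart v e) else den (chart v e))).
  rewrite prod_chart //; case: ifP => // _; rewrite [in RHS]big_mkcond.
  by apply: eq_bigr => i _; rewrite inE.
by move=> e _; rewrite inE; case: (e \in T).
Qed.

End Chart.

Lemma imset_enum_val (I : finType) (A : {set I}) :
  [set enum_val i | i : 'I_#|A|] = A.
Proof.
apply/setP => e; apply/imsetP/idP => [[i _ ->] | eA]; first exact: enum_valP.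
by exists (enum_rank_in eA e); rewrite ?enum_rankK_in.
Qed.

Lemma meval_map_sum_prod m (I : finType) (P : pred I) (Q : I -> pred 'I_m)
    (v : 'I_m -> F) :
  (map_mpoly intr (\sum_(T | P T) \prod_(i | Q T i) 'X_i : {mpoly int[m]})).@[v] =
  \sum_(T | P T) \prod_(i | Q T i) v i.
Proof.
rewrite [map_mpoly _ _]rmorph_sum /= rmorph_sum /=; apply: eq_bigr => T _.
rewrite [map_mpoly _ _]rmorph_prod /= rmorph_prod /=; apply: eq_bigr => i _.
by rewrite map_mpolyX mevalXU.
Qed.

Lemma nb_zeros_phi_sub J :
  nb_zeros F (phi_sub J set0) = #|[set p | (poles p == J) && (phi_hom p == 0)]|.
Proof.
have := card_chart (f := enum_val) (@enum_val_inj _ (~: (set0 :|: J)))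
  (fun p => phi_hom p == 0).
have imE : ~: [set enum_val i | i : 'I_#|~: (set0 :|: J)|] = J.
  by rewrite imset_enum_val setCK set0U.
rewrite imE => <-; apply: eq_card => v; rewrite !inE; congr (_ == 0).
rewrite meval_map_sum_prod phi_hom_chart ?imE; last exact: enum_val_inj.
apply: eq_big => T; first by rewrite disjoint_sym disjoints_subset sub0set andbT.
move=> _; apply: eq_bigl => i; rewrite in_setD.
by have := enum_valP i; rewrite !inE => ->.
Qed.

Lemma imset_id m : [set i | i : 'I_m] = setT.
Proof. by apply/setP => i; rewrite inE; apply/imsetP; exists i. Qed.

Lemma nb_zeros_phi :
  nb_zeros F (phi G) = #|[set p | (poles p == set0) && (phi_hom p == 0)]|.
Proof.
have := card_chart (@inj_id 'I_N) (fun p => phi_hom p == 0).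
rewrite imset_id setCT => <-; apply: eq_card => v; rewrite !inE; congr (_ == 0).
rewrite meval_map_sum_prod phi_hom_chart ?imset_id ?setCT //.
by apply: eq_bigl => T; rewrite sub0set andbT.
Qed.

Lemma nb_zeros_Psi :
  nb_zeros F (Psi G) = #|[set p | (poles p == set0) && (psi_hom p == 0)]|.
Proof.
have := card_chart (@inj_id 'I_N) (fun p => psi_hom p == 0).
rewrite imset_id setCT => <-; apply: eq_card => v; rewrite !inE; congr (_ == 0).
rewrite meval_map_sum_prod psi_hom_chart ?imset_id ?setCT //.
by apply: eq_bigl => T; rewrite sub0set andbT.
Qed.

End ProjectivePoints.

(** * Zeros of the graph polynomial modulo q^3 *)

Section ZerosOfPsi.

Variables (G : multigraph) (r : vertex G) (F : finFieldType).
Local Notation N := (nb_edges G).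
Local Notation n := #|[set~ r]|.
Local Notation q := #|F|.

Variables (k : nat) (f : 'I_k -> 'I_N).
Hypothesis f_inj : injective f.
Local Notation im := [set f i | i : 'I_k].
Local Notation E := (incidence r F).
Local Notation Ef := (rowsub f E).

(** These are Kirchhoff's laws on the subgraph of the finite edges, for a current [x], a potential
    [z] and resistances [v]. They describe the left kernel of the matrix [kirchhoff], whose
    coordinates at infinite edges are determined by [z]. *)
Lemma psi_hom_chart_eq0 (v : {ffun 'I_k -> F}) :
  reflect (exists x : 'rV[F]_k, exists z : 'rV[F]_n,
     [/\ (x != 0) || (z != 0), x *m Ef = 0 &
         x *m diag_mx (\row_i v i) = z *m Ef^T])
    (psi_hom (chart f v) == 0).
Proof.
rewrite /psi_hom -(det_kirchhoff r).
have EfT (z : 'rV[F]_n) i : (z *m Ef^T) 0 i = (z *m E^T) 0 (f i).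
  by rewrite !mxE; apply: eq_bigr => j _; rewrite !mxE.
have denE (x : 'rV[F]_N) :
    x *m diag_mx (\row_e (@den F \o chart f v) e) *m E = colsub f x *m Ef.
  apply/rowP => j; rewrite !mxE (sum_imset_split _ f_inj) [X in _ + X]big1.
    rewrite addr0; apply: eq_bigr => i _.
    by rewrite mul_mx_diag !mxE /= chart_im // mulr1.
  by move=> e ef; rewrite mul_mx_diag !mxE /= chart_notin // mulr0 mul0r.
apply: (iffP (det0P)) => [[xz xz0] | [x [z [xz0 xE xv]]]].
  rewrite -[xz]hsubmxK in xz0 *; set x := lsubmx xz in xz0 *.
  set z := rsubmx xz in xz0 *; rewrite mul_row_block mulmx0 addr0 mulmxA denE.
  move/eqP; rewrite row_mx_eq0 mulmxN subr_eq0 => /andP[/eqP xu /eqP xE].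
  exists (colsub f x), z; split=> //; last first.
    apply/rowP => i; rewrite EfT -xu !mul_mx_diag !mxE /= chart_im //.
  apply: contraR xz0; rewrite negb_or !negbK => /andP[/eqP x0 /eqP z0].
  rewrite z0 row_mx_eq0 eqxx andbT; apply/eqP/rowP => e; rewrite [RHS]mxE.
  have [/imsetP[i _ ->] | ef] := boolP (e \in im).
    by have /rowP/(_ i) := x0; rewrite !mxE.
  have /rowP/(_ e) := xu; rewrite z0 mul0mx mul_mx_diag !mxE /= chart_notin //.
  by rewrite mulr1.
(* At an infinite edge [num] is 1 and [den] is 0, which forces this coordinate. *)
pose y : 'rV[F]_N := \row_e (if pinv f e is Some i then x 0 i else (z *m E^T) 0 e).
have yx : colsub f y = x by apply/rowP => i; rewrite !mxE pinvK.
exists (row_mx y z).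
  apply: contraL xz0 => /eqP yz0; rewrite negb_or !negbK -yx.
  have /(congr1 lsubmx) := yz0; have /(congr1 rsubmx) := yz0.
  rewrite row_mxKr row_mxKl !linear0 => -> ->; rewrite eqxx andbT.
  by apply/eqP/rowP => i; rewrite !mxE.
rewrite mul_row_block mulmx0 addr0 mulmxA denE yx xE mulmxN.
suff -> : y *m diag_mx (\row_e (@num F \o chart f v) e) = z *m E^T.
  by rewrite subrr row_mx0.
apply/rowP => e; rewrite mul_mx_diag mxE [y 0 e]mxE [X in _ * X]mxE /=.
have [/imsetP[i _ ->] | ef] := boolP (e \in im).
  rewrite pinvK // chart_im // -EfT -xv mul_mx_diag !mxE //.
by rewrite pinv_notin // chart_notin // mulr1.
Qed.

(** The rows of [C] are a basis of the cycle space, and the potential differences are its orthogonal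
    complement. Hence [z] can be eliminated: the current y C solves the system iff [y] is in the
    kernel of the restricted form. *)
Lemma psi_hom_chart_singular (v : {ffun 'I_k -> F}) : \rank Ef = n ->
  (psi_hom (chart f v) == 0) =
  (\det (diag_form (row_base (kermx Ef)) (\row_i v i)) == 0).
Proof.
move=> rEf; set C := row_base _.
have eqC : (C :=: kermx Ef)%MS := eq_row_base _.
have CE : C *m Ef = 0 by apply/sub_kermxP; rewrite eqC.
have CET : Ef^T *m C^T = 0 by rewrite -trmx_mul CE trmx0.
have freeC : row_free C := row_base_free _; clearbody C.
have freeEf : row_free Ef^T by rewrite /row_free mxrank_tr rEf.
apply/psi_hom_chart_eq0/det0P => [[x [z [xz0 xE xv]]] | [y y0]].
  have /submxP[y yC] : (x <= C)%MS by rewrite eqC; apply/sub_kermxP.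
  exists y; last by rewrite /diag_form !mulmxA -yC xv -mulmxA CET mulmx0.
  apply: contraL xz0 => /eqP y0; rewrite yC y0 mul0mx eqxx /= negbK.
  rewrite yC y0 !mul0mx in xv; apply/eqP/(row_free_inj freeEf).
  by rewrite -xv mul0mx.
rewrite /diag_form !mulmxA => /sub_kermxP yv.
(* One inclusion holds by orthogonality, and both spaces have dimension [n]. *)
have eqE : (Ef^T :=: kermx C^T)%MS.
  apply/eqmxP; rewrite -mxrank_leqif_eq; last exact/sub_kermxP.
  rewrite mxrank_tr mxrank_ker mxrank_tr eqC mxrank_ker rEf subKn //.
  by rewrite -rEf rank_leq_row.
have /submxP[z zE] : (y *m C *m diag_mx (\row_i v i) <= Ef^T)%MS by rewrite eqE.
exists (y *m C), z; split=> //; last by rewrite -mulmxA CE mulmx0.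
apply/orP; left; apply: contra y0 => /eqP yC0; apply/eqP/(row_free_inj freeC).
by rewrite mul0mx.
Qed.

Lemma card_ffun_row (Q : pred 'rV[F]_k) :
  #|[set v : {ffun 'I_k -> F} | Q (\row_i v i)]| = #|[set v | Q v]|.
Proof.
have row_inj : injective (fun v : {ffun 'I_k -> F} => \row_i v i).
  by move=> v w /rowP vw; apply/ffunP => i; have := vw i; rewrite !mxE.
rewrite -(card_imset _ row_inj); apply: eq_card => v; rewrite inE.
have vE : \row_i [ffun j => v 0 j] i = v by apply/rowP => i; rewrite !mxE ffunE.
apply/imsetP/idP => [[w + ->] | Qv]; first by rewrite inE.
by exists [ffun j => v 0 j]; rewrite ?inE vE.
Qed.

(** In full rank the cycle space has dimension h = k - n, so n >= 3 and k < 2n become h + 3 <= k and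
    2h < k. *)
Lemma dvdn_card_psi_zeros : (3 <= n)%N -> (n <= k)%N -> (k < n.*2)%N ->
  (q ^ 3 %| #|[set v : {ffun 'I_k -> F} | (psi_hom (chart f v) == 0)%R]|)%N.
Proof.
move=> n3 nk kn; have rn : (\rank Ef <= n)%N := rank_leq_col _.
have [rEf | nEf] := eqVneq (\rank Ef) n.
  rewrite (eq_card (B := [set v : {ffun 'I_k -> F} |
     \det (diag_form (row_base (kermx Ef)) (\row_i v i)) == 0])); last first.
    by move=> v; rewrite !inE psi_hom_chart_singular.
  rewrite (card_ffun_row (fun v => \det (diag_form _ v) == 0)).
  by apply: dvdn_card_singular_forms; rewrite mxrank_ker rEf; lia.
(* In lower rank a nonzero potential has no differences along the finite edges, so all q^k points
   are zeros. *)
rewrite (eq_card (B := predT)); last first.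
  move=> v; rewrite !inE; apply/psi_hom_chart_eq0.
  have /rowV0Pn[z /sub_kermxP zE z0] : kermx Ef^T != 0.
    by rewrite -mxrank_eq0 mxrank_ker mxrank_tr -lt0n subn_gt0 ltn_neqAle nEf.
  by exists 0, z; rewrite z0 orbT !mul0mx.
by rewrite card_ffun card_ord dvdn_exp2l //; lia.
Qed.

End ZerosOfPsi.

(** * Points with many infinite coordinates *)

Section ManyPoles.

Variables (G : multigraph) (r : vertex G) (F : finFieldType).
Local Notation N := (nb_edges G).
Local Notation n := #|[set~ r]|.

(** A tree contributes only if it contains all poles, but it has just [n] edges. *)
Lemma phi_hom_many_poles (p : {ffun 'I_N -> option F}) :
  (n < #|poles p|)%N -> phi_hom p = 0.
Proof.
move=> ltn; apply: big1 => T stT; have cT := card_spanning_tree r stT.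
have /subsetPn[e] : ~~ (poles p \subset T).
  by apply: contraL ltn => /subset_leq_card; rewrite cT -leqNgt.
rewrite inE => /eqP pe eT; rewrite (bigD1 e) //= (negPf eT) pe.
by rewrite /den mul0r.
Qed.

Lemma psi_hom_many_poles (p : {ffun 'I_N -> option F}) :
  (N < #|poles p| + n)%N -> psi_hom p = 0.
Proof.
move=> ltn; apply: big1 => T stT; have cT := card_spanning_tree r stT.
have /subsetPn[e] : ~~ (poles p \subset ~: T).
  apply: contraL ltn => /subset_leq_card.
  by have := cardsC T; rewrite card_ord cT -leqNgt; lia.
rewrite !inE negbK => /eqP pe eT; rewrite (bigD1 e) //= eT pe.
by rewrite /den mul0r.
Qed.

End ManyPoles.

(** * Comparison modulo q^3 and conclusion *)

Lemma natr_divn_Zp (m a b : nat) : (1 < m)%N -> a = b %[mod m ^ 3] ->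
  (a %/ m ^ 2)%:R = (b %/ m ^ 2)%:R :> 'Z_m.
Proof.
move=> m1 ab.
have red c : (c %/ m ^ 2)%:R = ((c %% m ^ 3) %/ m ^ 2)%:R :> 'Z_m.
  (* A multiple of m^3 contributes a multiple of m to the quotient by m^2, hence 0 in ['Z_m]. *)
  rewrite {1}(divn_eq c (m ^ 3)) expnS -!expnS {2}expnS mulnA.
  rewrite divnMDl ?expn_gt0 ?(ltnW m1) // natrD natrM pchar_Zp //.
  by rewrite mulr0 add0r.
by rewrite red ab -red.
Qed.

Lemma admissible_nb_zeros (G : multigraph) (F : finFieldType) :
  duality_admissible G -> nb_zeros F (phi G) = nb_zeros F (Psi G) %[mod #|F| ^ 3].
Proof.
case=> ld _ n3 adm; rewrite /log_divergent /hG /nG in ld n3 adm.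
have [r _] : exists r : vertex G, true.
  have : (0 < #|vertex G|)%N by lia.
  by case/card_gt0P => r _; exists r.
have cV : #|[set~ r]|.+1 = #|vertex G|.
  by rewrite cardsC1 prednK //; apply/card_gt0P; exists r.
pose n := #|[set~ r]|; have NE : nb_edges G = n.*2 by rewrite /n; lia.
have n3' : (3 <= n)%N by rewrite /n; lia.
pose a J := #|[set p : {ffun _ -> option F} | (poles (G := G) p == J) && (phi_hom p == 0)]|.
pose b J := #|[set p : {ffun _ -> option F} | (poles (G := G) p == J) && (psi_hom p == 0)]|.
have ab : (\sum_J a J = \sum_J b J)%N.
  by rewrite -!card_by_poles card_phi_psi_hom.
have q_gt1 : (1 < #|F|)%N := card_finNzRing_gt1 F.
have q3 : (1 < #|F| ^ 3)%N by rewrite -[1%N](exp1n 3) ltn_exp2r.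
suff abJ J : J != set0 -> (a J)%:R = (b J)%:R :> 'Z_(#|F| ^ 3).
  rewrite nb_zeros_phi nb_zeros_Psi -/(a set0) -/(b set0).
  suff : (a set0)%:R = (b set0)%:R :> 'Z_(#|F| ^ 3).
    by move/(congr1 val); rewrite /= !val_Zp_nat.
  move/(congr1 (fun m => m%:R : 'Z_(#|F| ^ 3))): ab.
  rewrite !natr_sum (bigD1 set0) //= [RHS](bigD1 set0) //=.
  by rewrite (eq_bigr _ abJ) => /addIr.
(* As N = 2n, both polynomials vanish identically once there are more than [n] poles. *)
move=> J0; have [leJ | ltJ] := leqP #|J| n; last first.
  congr (_%:R); apply: eq_card => p; rewrite !inE; case: eqP => //= pJ.
  rewrite (phi_hom_many_poles (r := r)) ?pJ // (psi_hom_many_poles (r := r)) //.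
  by rewrite pJ; move: NE ltJ; rewrite -/n; lia.
have J_gt0 : (0 < #|J|)%N by rewrite card_gt0.
(* Admissibility is applied with [I] empty, so that |I| < |J| holds for nonempty [J]. *)
have /eqP -> : (a J)%:R == 0 :> 'Z_(#|F| ^ 3).
  rewrite natr_Zp_eq0 // /a -nb_zeros_phi_sub; apply: adm.
  - by rewrite disjoints_subset sub0set.
  - by rewrite cards0.
  - by rewrite /n in leJ; lia.
  - by rewrite cards0; lia.
apply/esym/eqP; rewrite natr_Zp_eq0 // /b.
have := card_chart (f := enum_val) (@enum_val_inj _ (~: J))
  (fun p => psi_hom (F := F) p == 0).
rewrite imset_enum_val setCK => <-.
have := cardsC J; rewrite card_ord => cJ.
(* The number of finite edges is 2n - |J| with 0 < |J| <= n. *)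
have [d_ge d_lt] : (n <= #|~: J|)%N /\ (#|~: J| < n.*2)%N by lia.
exact: (dvdn_card_psi_zeros (r := r) F (f := enum_val) (@enum_val_inj _ (~: J))).
Qed.

Theorem theorem5 (G : multigraph) (hadm : duality_admissible G)
    (F : finFieldType) : c2_dual G F = c2 G F.
Proof.
apply: natr_divn_Zp; first exact: card_finNzRing_gt1.
exact: admissible_nb_zeros.
Qed.
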